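(* Let $K$ be an abelian group (written multiplicatively), let $Q$ be a C-loop, and let $C$ be a loop. The following conditions are equivalent: (i) $C$ is a C-loop extension of $K$ by $Q$ with $K \le N(C)$; that is, $C$ is a C-loop having a normal subloop (identified with $K$ via an isomorphism) that is contained in the nucleus $N(C)$ and whose quotient is isomorphic to $Q$; (ii) there are a homomorphism $\theta : Q \to \mathrm{Aut}(K)$ and a map $f : Q\times Q \to K$ such that $(\theta,f)$ is a C-factor set and $C$ is isomorphic to $K\ltimes_\theta^f Q$.
   Context: A C-loop is a loop satisfying the identity $x(y\cdot yz) = (xy\cdot y)z$ (here $\cdot$ binds less tightly than juxtaposition). The nucleus $N(C)$ of a loop $C$ is the set of all $a\in C$ such that $a(xy)=(ax)y$, $x(ay)=(xa)y$ and $x(ya)=(xy)a$ for all $x,y\in C$. A loop $C$ is an extension of $K$ by $Q$ if $K$ is a normal subloop of $C$ and $C/K\cong Q$. Let $K$ be an abelian group, $Q$ a C-loop, $\theta: Q\to \mathrm{Aut}(K)$, $x\mapsto\theta_x$, a homomorphism (so $\theta_{xy}=\theta_x\theta_y$), and $f:Q\times Q\to K$ a map. The pair $(\theta,f)$ is a C-factor set if $f(x,1)=1=f(1,x)$ for all $x\in Q$ and $$\theta_{xy}f(y,z)\cdot \theta_x f(y,yz)\cdot f(x,y\cdot yz) = f(x,y)\cdot f(xy,y)\cdot f(xy\cdot y,z)$$ for all $x,y,z\in Q$. The groupoid $K\ltimes_\theta^f Q$ is the set $K\times Q$ with the operation $(a,x)*(b,y) = (a\cdot\theta_x(b)\cdot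 f(x,y),\ xy)$ for $a,b\in K$, $x,y\in Q$. *)

(* Defs.v *)
From HB Require Import structures.
From mathcomp Require Import all_boot.
From mathcomp Require Import boolp classical_sets.

Set Implicit Arguments.
Unset Strict Implicit.
Unset Printing Implicit Defensive.

Local Open Scope classical_set_scope.
Local Open Scope group_scope.

HB.mixin Record UMagma_isLoop C of UMagma C := {
  ldiv_uniq : forall a b : C, exists! x, a * x = b;
  rdiv_uniq : forall a b : C, exists! y, y * a = b
}.

#[short(type="loopType")]
HB.structure Definition Loop := {C of UMagma_isLoop C & UMagma C}.

Bind Scope group_scope with Loop.sort.

Definition isomorphic (G H : magmaType) : Prop :=
  exists phi : {multiplicative G -> H}, bijective phi.

Definition is_C_loop (C : loopType) : Prop :=
  forall x y z : C, x * (y * (y * z)) = ((x * y) * y) * z.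

Definition nucleus (C : loopType) : set C :=
  [set a | forall x y : C,
     [/\ a * (x * y) = (a * x) * y,
         x * (a * y) = (x * a) * y
       & x * (y * a) = (x * y) * a]].

Arguments nucleus C : clear implicits.

Definition lcos (C : loopType) (x : C) (A : set C) : set C :=
  [set x * a | a in A].

Definition rcos (C : loopType) (A : set C) (x : C) : set C :=
  [set a * x | a in A].

(* The last two clauses say that N is closed under left and right division. *)
Definition is_subloop (C : loopType) (N : set C) : Prop :=
  [/\ N 1,
      forall a b, N a -> N b -> N (a * b),
      forall a x, N a -> N (a * x) -> N x
    & forall a y, N a -> N (y * a) -> N y].

Definition is_normal (C : loopType) (N : set C) : Prop :=
  [/\ forall x, lcos x N = rcos N x,
      forall x y, lcos x (lcos y N) = lcos (x * y) N
    & forall x y, rcos (rcos N x) y = rcos N (x * y)].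

Record normal_subloop (C : loopType) := NormalSubloop {
  subloop_set :> set C;
  subloopP : is_subloop subloop_set;
  normalP : is_normal subloop_set
}.

Record subloop_type (C : loopType) (N : normal_subloop C) := SubloopElt {
  subloop_val : C;
  subloop_valP : subloop_val \in (N : set C)
}.

(* C / N: its elements are the cosets xN, multiplied setwise; see mul_lcos *)
Record quotient (C : loopType) (N : normal_subloop C) := QuotientElt {
  quotient_val : set C;
  quotient_valP : quotient_val \in [set lcos x N | x in [set: C]]
}.

Section SubloopTheory.
Variables (C : loopType) (N : normal_subloop C).

Lemma loop_mulgI (a : C) : injective (mul a).
Proof.
move=> x y exy; case: (ldiv_uniq a (a * y)) => z [_ zu].
by rewrite -(zu x exy) (zu y erefl).
Qed.

Lemma loop_mulIg (a : C) : injective (mul^~ a).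
Proof.
move=> x y exy; case: (rdiv_uniq a (y * a)) => z [_ zu].
by rewrite -(zu x exy) (zu y erefl).
Qed.

HB.instance Definition _ := [isSub for @subloop_val C N].
HB.instance Definition _ := [Choice of subloop_type N by <:].

Fact subloop_mul_subproof (a b : subloop_type N) :
  val a * val b \in (N : set C).
Proof.
case: (subloopP N) => _ NM _ _; apply/mem_set/NM; exact: set_mem (valP _).
Qed.

Definition subloop_mul (a b : subloop_type N) : subloop_type N :=
  SubloopElt (subloop_mul_subproof a b).

HB.instance Definition _ := hasMul.Build (subloop_type N) subloop_mul.

Fact subloop_one_subproof : 1 \in (N : set C).
Proof. by case: (subloopP N) => N1 _ _ _; apply/mem_set. Qed.

Definition subloop_one : subloop_type N := SubloopElt subloop_one_subproof.

Fact subloop_mul1g : left_id subloop_one (@mul (subloop_type N)).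
Proof. by move=> a; apply: val_inj; rewrite /= mul1g. Qed.

Fact subloop_mulg1 : right_id subloop_one (@mul (subloop_type N)).
Proof. by move=> a; apply: val_inj; rewrite /= mulg1. Qed.

HB.instance Definition _ :=
  Magma_isUMagma.Build (subloop_type N) subloop_mul1g subloop_mulg1.

Fact subloop_ldiv (a b : subloop_type N) : exists! x, a * x = b.
Proof.
case: (subloopP N) => _ _ Nl _.
have [x [ex ux]] := ldiv_uniq (val a) (val b).
have Nx : x \in (N : set C).
  apply/mem_set/(Nl (val a)); first exact: set_mem (valP a).
  by rewrite ex; exact: set_mem (valP b).
exists (SubloopElt Nx); split; first exact: val_inj.
by move=> y eyb; apply: val_inj; apply: ux; rewrite -eyb.
Qed.

Fact subloop_rdiv (a b : subloop_type N) : exists! y, y * a = b.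
Proof.
case: (subloopP N) => _ _ _ Nr.
have [x [ex ux]] := rdiv_uniq (val a) (val b).
have Nx : x \in (N : set C).
  apply/mem_set/(Nr (val a)); first exact: set_mem (valP a).
  by rewrite ex; exact: set_mem (valP b).
exists (SubloopElt Nx); split; first exact: val_inj.
by move=> y eyb; apply: val_inj; apply: ux; rewrite -eyb.
Qed.

HB.instance Definition _ :=
  UMagma_isLoop.Build (subloop_type N) subloop_ldiv subloop_rdiv.

Lemma mul_lcos (x y : C) :
  [set a * b | a in lcos x N & b in lcos y N] = lcos (x * y) N.
Proof.
have [NxE lN rN] := normalP N; have [N1 NM Nl _] := subloopP N.
have NrE u z : rcos (lcos u N) z = lcos (u * z) N by rewrite NxE rN NxE.
have NlE u n : (N : set C) n -> lcos (u * n) N = lcos u N.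
  move=> Nn; rewrite -lN; congr lcos; apply/seteqP; split=> [_ [m Nm <-]|m Nm].
    exact: NM.
  have [k [ek _]] := ldiv_uniq n m; exists k => //.
  by apply: (Nl n) => //; rewrite ek.
apply/seteqP; split=> [_ [a Na [b Nb <-]]|c].
  have : rcos (lcos x N) b (a * b) by exists a.
  rewrite NrE; have [n Nn <-] : lcos (x * y) N (x * b).
    by rewrite -lN; exists b.
  by rewrite NlE.
rewrite -lN => -[b Nb <-]; exists x; first by exists 1; rewrite ?mulg1.
by exists b.
Qed.

HB.instance Definition _ := [isSub for @quotient_val C N].
HB.instance Definition _ := [Choice of quotient N by <:].

Fact quotient_mul_subproof (A B : quotient N) :
  [set a * b | a in val A & b in val B] \in [set lcos x N | x in [set: C]].
Proof.
have [x _ <-] := set_mem (valP A); have [y _ <-] := set_mem (valP B).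
by apply/mem_set; exists (x * y); rewrite // mul_lcos.
Qed.

Definition quotient_mul (A B : quotient N) : quotient N :=
  QuotientElt (quotient_mul_subproof A B).

HB.instance Definition _ := hasMul.Build (quotient N) quotient_mul.

Fact to_quotient_subproof (x : C) :
  lcos x N \in [set lcos x N | x in [set: C]].
Proof. by apply/mem_set; exists x. Qed.

Definition to_quotient (x : C) : quotient N :=
  QuotientElt (to_quotient_subproof x).

Lemma to_quotientM (x y : C) :
  to_quotient (x * y) = to_quotient x * to_quotient y.
Proof. by apply: val_inj; rewrite /= mul_lcos. Qed.

Lemma to_quotient_surj (A : quotient N) : exists x, to_quotient x = A.
Proof. by have [x _ xA] := set_mem (valP A); exists x; apply: val_inj. Qed.

Fact quotient_mul1g : left_id (to_quotient 1) (@mul (quotient N)).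
Proof.
by move=> A; have [x <-] := to_quotient_surj A; rewrite -to_quotientM mul1g.
Qed.

Fact quotient_mulg1 : right_id (to_quotient 1) (@mul (quotient N)).
Proof.
by move=> A; have [x <-] := to_quotient_surj A; rewrite -to_quotientM mulg1.
Qed.

HB.instance Definition _ :=
  Magma_isUMagma.Build (quotient N) quotient_mul1g quotient_mulg1.

Fact quotient_ldiv (A B : quotient N) : exists! X, A * X = B.
Proof.
have [_ lN _] := normalP N.
have [a <-] := to_quotient_surj A; have [b <-] := to_quotient_surj B.
have [x [ex _]] := ldiv_uniq a b.
exists (to_quotient x); split=> [|Y]; first by rewrite -to_quotientM ex.
have [y <-] := to_quotient_surj Y; rewrite -to_quotientM -ex.
move/(congr1 val); rewrite /= -!lN => eyx; apply: val_inj => /=.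
have limgI (S T : set C) : lcos a S = lcos a T -> S `<=` T.
  move=> eST s Ss; have [t Tt /loop_mulgI <- //] : lcos a T (a * s).
  by rewrite -eST; exists s.
by apply/seteqP; split; apply: limgI.
Qed.

Fact quotient_rdiv (A B : quotient N) : exists! Y, Y * A = B.
Proof.
have [NxE _ rN] := normalP N.
have [a <-] := to_quotient_surj A; have [b <-] := to_quotient_surj B.
have [x [ex _]] := rdiv_uniq a b.
exists (to_quotient x); split=> [|Y]; first by rewrite -to_quotientM ex.
have [y <-] := to_quotient_surj Y; rewrite -to_quotientM -ex.
move/(congr1 val); rewrite /= !NxE -!rN => eyx; apply: val_inj; rewrite /= !NxE.
have rimgI (S T : set C) : rcos S a = rcos T a -> S `<=` T.
  move=> eST s Ss; have [t Tt /loop_mulIg <- //] : rcos T a (s * a).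
  by rewrite -eST; exists s.
by apply/seteqP; split; apply: rimgI.
Qed.

HB.instance Definition _ :=
  UMagma_isLoop.Build (quotient N) quotient_ldiv quotient_rdiv.

End SubloopTheory.

(* The group Aut(K) under composition: (s * t) a = s (t a) *)
Record aut (K : groupType) := Aut {
  aut_val :> {multiplicative K -> K};
  aut_bij : bijective aut_val
}.

Section AutMagma.
Variable K : groupType.

Definition aut_mul (s t : aut K) : aut K :=
  @Aut K (s \o t) (bij_comp (aut_bij s) (aut_bij t)).

HB.instance Definition _ := hasMul.Build (aut K) aut_mul.

End AutMagma.

Definition C_factor_set (K : groupType) (Q : loopType)
    (theta : {multiplicative Q -> aut K}) (f : Q -> Q -> K) : Prop :=
  (forall x : Q, f x 1 = 1 /\ f 1 x = 1) /\
  (forall x y z : Q,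
     theta (x * y) (f y z) * theta x (f y (y * z)) * f x (y * (y * z)) =
     f x y * f (x * y) y * f ((x * y) * y) z).

(* The set K * Q, as a type constant indexed by theta and f: the bare type
   K * Q canonically carries the componentwise product. *)
Definition twisted_prod (K : groupType) (Q : loopType)
    (theta : {multiplicative Q -> aut K}) (f : Q -> Q -> K) : Type :=
  (K * Q)%type.

Section TwistedProduct.
Variables (K : groupType) (Q : loopType).
Variables (theta : {multiplicative Q -> aut K}) (f : Q -> Q -> K).

Definition twisted_mul (u v : twisted_prod theta f) : twisted_prod theta f :=
  (u.1 * theta u.2 v.1 * f u.2 v.2, u.2 * v.2).

HB.instance Definition _ := hasMul.Build (twisted_prod theta f) twisted_mul.

End TwistedProduct.

(* Main.v *)
(** Choose a section [s] of the quotient map with [s 1 = 1].  As [K] sits in the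
    nucleus, each [c] acts on [K] by [c a = T_c(a) c], the map [c |-> T_c] is
    multiplicative, and it factors through [Q] because [K] is commutative.  With
    [s x * s y = f(x, y) * s (x y)], the normal form [a * s x] identifies [C]
    with the twisted product, where the C-law is exactly the factor set
    identity.  Conversely, [K * 1] is the kernel of the second projection, and
    it is nuclear because [f] is normalized. *)
Require Import Defs.
From HB Require Import structures.
From mathcomp Require Import all_boot.
From mathcomp Require Import boolp classical_sets.

Local Open Scope classical_set_scope.
Local Open Scope group_scope.

Lemma inj_surj_bijective {A B : Type} (g : A -> B) :
  injective g -> (forall b, exists a, g a = b) -> bijective g.
Proof.
move=> gI gS; have [h gh] := choice gS.
by exists h => // a; apply: gI.
Qed.

Lemma isomorphic_of_morph {G H : magmaType} (g : G -> H) :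
  {morph g : x y / x * y} -> injective g -> (forall y, exists x, g x = y) ->
  isomorphic G H.
Proof.
move=> gM gI gS; pose m := isMultiplicative.Build G H g gM.
pose phi : {multiplicative G -> H} := HB.pack g m.
by exists phi; apply: inj_surj_bijective.
Qed.

Lemma loop_idem_eq1 {Q : loopType} (q : Q) : q * q = q -> q = 1.
Proof. by rewrite -[RHS]mulg1 => /loop_mulgI. Qed.

Lemma loop_morph1 {C Q : loopType} {p : C -> Q} :
  {morph p : x y / x * y} -> p 1 = 1.
Proof. by move=> pM; apply: loop_idem_eq1; rewrite -pM mulg1. Qed.

Section Kernel.
Context {C Q : loopType} {p : C -> Q} (pM : {morph p : x y / x * y}).

(** Left division solves [x * c = d], and cancelling [p x] in [Q] puts [c] in the fiber over [q].
    Cosets of the kernel are thus fibers of [p], and normality reduces to identities in [Q]. *)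
Lemma lcos_fiber (x : C) (q : Q) :
  lcos x [set c | p c = q] = [set c | p c = p x * q].
Proof.
apply/seteqP; split=> [_ [c /= <- <-]|d /= pd]; first by rewrite /= pM.
have [c [xc _]] := ldiv_uniq x d; exists c => //=.
by apply: (@loop_mulgI _ (p x)); rewrite -pM xc.
Qed.

Lemma rcos_fiber (x : C) (q : Q) :
  rcos [set c | p c = q] x = [set c | p c = q * p x].
Proof.
apply/seteqP; split=> [_ [c /= <- <-]|d /= pd]; first by rewrite /= pM.
have [c [cx _]] := rdiv_uniq x d; exists c => //=.
by apply: (@loop_mulIg _ (p x)); rewrite /= -pM cx.
Qed.

Lemma kernel_subloop : is_subloop [set c | p c = 1].
Proof.
split=> [|a b /= pa pb|a x /= pa|a y /= pa] /=.
- exact: loop_morph1.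
- by rewrite pM pa pb mulg1.
- by rewrite pM pa mul1g.
- by rewrite pM pa mulg1.
Qed.

Lemma kernel_normal : is_normal [set c | p c = 1].
Proof.
split=> [x|x y|x y].
- by rewrite lcos_fiber rcos_fiber mulg1 mul1g.
- by rewrite !lcos_fiber !mulg1 pM.
- by rewrite !rcos_fiber !mul1g pM.
Qed.

Definition kernel : normal_subloop C := NormalSubloop kernel_subloop kernel_normal.

Lemma to_kernel_quotient_eq (x y : C) :
  to_quotient kernel x = to_quotient kernel y <-> p x = p y.
Proof.
split=> [/(congr1 val)|pxy].
  rewrite /= !lcos_fiber !mulg1 => exy.
  by have : [set c | p c = p x] x by []; rewrite exy.
by apply: val_inj; rewrite /= !lcos_fiber pxy.
Qed.

Lemma kernel_quotient_isomorphic :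
  (forall q, exists x, p x = q) -> isomorphic (quotient kernel) Q.
Proof.
(* [r] picks a representative of each coset; the value of [p] there does not depend on the choice,
   because cosets of the kernel are fibers of [p]. *)
move=> pS; have [r rK] := choice (@to_quotient_surj C kernel).
apply: (@isomorphic_of_morph _ _ (p \o r)) => [A B|A B|q] /=.
- by rewrite -pM; apply/to_kernel_quotient_eq; rewrite to_quotientM !rK.
- by move=> /to_kernel_quotient_eq; rewrite !rK.
- have [x <-] := pS q; exists (to_quotient kernel x).
  by apply/to_kernel_quotient_eq.
Qed.

End Kernel.

Lemma aut_eq {K : groupType} (s t : aut K) : s =1 t -> s = t.
Proof.
case: s t => [[s [[sM]]] sb] [[t [[tM]]] tb] /= /funext st.
by subst t; rewrite (Prop_irrelevance tM sM) (Prop_irrelevance tb sb).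
Qed.

(** [aut K] carries only a product, so preservation of the unit has to be derived: [theta 1] is
    idempotent under composition and injective. *)
Lemma aut_morph1 {K : groupType} {Q : loopType}
    (theta : {multiplicative Q -> aut K}) (a : K) : theta 1 a = a.
Proof.
apply: (bij_inj (aut_bij (theta 1))).
by have /(congr1 (fun s : aut K => s a)) := gmulfM (s := theta) 1 1; rewrite mulg1.
Qed.

Lemma aut_morphM {K : groupType} {Q : loopType}
    (theta : {multiplicative Q -> aut K}) (x y : Q) (a : K) :
  theta (x * y) a = theta x (theta y a).
Proof. by rewrite (gmulfM (s := theta)). Qed.

Lemma autM {K : groupType} (s : aut K) : {morph s : a b / a * b}.
Proof. exact: gmulfM. Qed.

Lemma aut1 {K : groupType} (s : aut K) : s 1 = 1.
Proof. by apply: (mulgI (s 1)); rewrite -autM !mulg1. Qed.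

Section TwistedProduct.
Context {K : groupType} {Q : loopType}.
Context (theta : {multiplicative Q -> aut K}) (f : Q -> Q -> K).
Hypothesis K_abelian : commutative (@mul K).
Hypothesis f1 : forall x : Q, f x 1 = 1 /\ f 1 x = 1.

Local Notation T := (twisted_prod theta f).

Lemma twisted_mulE (a b : K) (x y : Q) :
  ((a, x) : T) * ((b, y) : T) = (a * theta x b * f x y, x * y).
Proof. by []. Qed.

Lemma twisted_mul1 (a : K) (u : T) : ((a, 1) : T) * u = (a * u.1, u.2).
Proof.
by case: u => b y; rewrite twisted_mulE aut_morph1 (f1 y).2 mulg1 mul1g.
Qed.

Lemma twisted_mulr1 (a : K) (u : T) :
  u * ((a, 1) : T) = (u.1 * theta u.2 a, u.2).
Proof. by case: u => b y; rewrite twisted_mulE (f1 y).1 !mulg1. Qed.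

(** Normalization removes every [f]-term involving [k]. In the third identity [f x y] must still
    move past the image of [a] under [theta (x * y)], which commutativity of [K] allows. *)
Lemma twisted_nuclear (a : K) (u v : T) (k := (a, 1) : T) :
  [/\ k * (u * v) = (k * u) * v,
      u * (k * v) = (u * k) * v
    & u * (v * k) = (u * v) * k].
Proof.
rewrite /k !twisted_mul1 !twisted_mulr1.
case: u v => [b x] [c y]; rewrite !twisted_mulE /= !autM aut_morphM !mulgA.
by split=> //; congr (_, _); rewrite -!mulgA; congr (_ * (_ * _)); rewrite K_abelian.
Qed.

(* Commutativity of [K] cancels the coordinates [a], [b], [c] from the C-law. *)
Lemma twisted_C_law : is_C_loop Q ->
  (forall u v w : T, u * (v * (v * w)) = ((u * v) * v) * w) <->
  C_factor_set theta f.
Proof.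
move=> QC; split=> [TC | [_ fC] [a x] [b y] [c z]].
  (* With trivial [K]-coordinates, the first component of the C-law is the factor set identity
     itself. *)
  split=> // x y z; have := TC (1, x) (1, y) (1, z).
  rewrite !twisted_mulE => -[+ _].
  by rewrite !autM !aut1 !mul1g !mulg1 aut_morphM.
rewrite !twisted_mulE; congr (_, _); last exact: QC.
have := fC x y z; rewrite !autM !aut_morphM !mulgA.
move: (theta x b) (theta x (theta y b)) (theta x (theta y (theta y c))).
(* On the left the three [f]-terms already stand together at the end, so [fE] turns them into those
   of the right side; what remains is reordering in [K]. *)
move=> b1 b2 c3 /= fE; rewrite -2!(mulgA (a * b1 * b2 * c3)) fE -!mulgA.
congr (a * (b1 * _)); rewrite [RHS]mulgA (K_abelian (f x y) b2) -mulgA.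
by congr (b2 * _); rewrite K_abelian -!mulgA; congr (_ * (_ * _)); rewrite K_abelian.
Qed.

End TwistedProduct.

(** The extension is encoded by an embedding with nuclear image and a surjection whose fibers are
    the cosets of that image. Only normalization of [f] is claimed: the factor set identity is
    obtained later by carrying the C-law across the isomorphism. *)
Lemma nuclear_extension_twisted {K : groupType} (K_abelian : commutative (@mul K))
    {Q C : loopType} (iota : K -> C) (p : C -> Q) :
  {morph iota : a b / a * b} -> injective iota ->
  (forall a, nucleus C (iota a)) ->
  {morph p : x y / x * y} -> (forall q, exists x, p x = q) ->
  (forall x y, p x = p y <-> exists a, x = iota a * y) ->
  exists (theta : {multiplicative Q -> aut K}) (f : Q -> Q -> K),
    (forall x : Q, f x 1 = 1 /\ f 1 x = 1) /\ isomorphic C (twisted_prod theta f).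
Proof.
move=> iM iI iN pM pS pE.
have i1 : iota 1 = 1 by apply: loop_idem_eq1; rewrite -iM mulg1.
have p1 := loop_morph1 pM.
have pi a : p (iota a) = 1 by rewrite -p1; apply/pE; exists a; rewrite mulg1.
have nl a x y : iota a * (x * y) = (iota a * x) * y by case: (iN a x y).
have nm a x y : x * (iota a * y) = (x * iota a) * y by case: (iN a x y).
have nr a x y : x * (y * iota a) = (x * y) * iota a by case: (iN a x y).
(* Both [c * iota a] and [c] have image [p c], so they differ by a left factor from [iota]; this
   factor is the conjugate of [a] by [c]. *)
have /choice[t tP] (ca : C * K) : exists b, ca.1 * iota ca.2 = iota b * ca.1.
  by apply/pE; rewrite pM pi mulg1.
pose T c a := t (c, a); have {tP}TP c a : c * iota a = iota (T c a) * c := tP (c, a).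
have TE c a b : c * iota a = iota b * c -> T c a = b.
  by rewrite TP => /loop_mulIg /iI.
have TM c : {morph T c : a b / a * b}.
  by move=> a b; apply: TE; rewrite !iM nr (TP c a) -nl (TP c b) nl.
have TI c : injective (T c).
  by move=> a b eT; apply/iI/(@loop_mulgI _ c); rewrite !TP eT.
have TS c b : exists a, T c a = b.
  (* The preimage of [b] is found by left division; its image under [p] is 1, which places it in the
     range of [iota]. *)
  have [x [cx _]] := ldiv_uniq c (iota b * c).
  have [a ea] : exists a, x = iota a * 1.
    by apply/pE; apply: (@loop_mulgI _ (p c)); rewrite p1 mulg1 -pM cx pM pi mul1g.
  by exists a; apply: TE; rewrite -cx ea mulg1.
have TMM c d a : T (c * d) a = T c (T d a).
  by apply: TE; rewrite -nr TP nm TP nl.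
(* If [c = iota k * d], then [T c] is [T d] followed by conjugation by [iota k], which is trivial on
   the commutative [K]. *)
have Tp c d a : p c = p d -> T c a = T d a.
  move=> /pE[k ->]; rewrite TMM; apply: TE.
  by rewrite -!iM K_abelian.
have /choice[s sP] q : exists c, p c = q /\ (q = 1 -> c = 1).
  have [->|q1] := pselect (q = 1); first by exists 1.
  by have [c pc] := pS q; exists c.
have ps q : p (s q) = q by case: (sP q).
have s1 : s 1 = 1 by case: (sP 1) => _ ->.
have /choice[g gP] (xy : Q * Q) :
    exists a, s xy.1 * s xy.2 = iota a * s (xy.1 * xy.2).
  by apply/pE; rewrite pM !ps.
pose f x y := g (x, y).
have {gP}fP x y : s x * s y = iota (f x y) * s (x * y) := gP (x, y).
have fE x y a : s x * s y = iota a * s (x * y) -> f x y = a.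
  by rewrite fP => /loop_mulIg /iI.
pose mul_T q := isMultiplicative.Build K K (T (s q)) (TM (s q)).
pose aut_T q : {multiplicative K -> K} := HB.pack (T (s q)) (mul_T q).
pose th q : aut K := @Aut K (aut_T q) (inj_surj_bijective _ (TI (s q)) (TS (s q))).
(* The section [s] need not be multiplicative, but [s (x * y)] and [s x * s y] lie over the same
   element of [Q], so they act alike by [Tp]. *)
have thM : {morph th : x y / x * y}.
  by move=> x y; apply: aut_eq => a /=; rewrite -TMM; apply: Tp; rewrite pM !ps.
pose theta : {multiplicative Q -> aut K} :=
  HB.pack th (isMultiplicative.Build Q (aut K) th thM).
exists theta, f; split=> [x|].
  by split; apply: fE; rewrite s1 i1 !(mulg1, mul1g).
have /choice[k kP] c : exists a, c = iota a * s (p c) by apply/pE; rewrite ps.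
(* Uniqueness of the normal form: its coordinates can be read off any expression [iota a * s q]. *)
have kE c a q : c = iota a * s q -> k c = a /\ p c = q.
  move=> ec; have pc : p c = q by rewrite ec pM pi ps mul1g.
  by split=> //; apply: iI; apply: (@loop_mulIg _ (s q)); rewrite /= -ec -pc -kP.
apply: (@isomorphic_of_morph _ _ (fun c => (k c, p c) : twisted_prod theta f)).
- move=> c d; have [kcd pcd] : k (c * d) = k c * T (s (p c)) (k d) * f (p c) (p d)
      /\ p (c * d) = p c * p d.
    apply: kE; rewrite {1}(kP c) {1}(kP d) -nl nm TP -nl fP.
    by rewrite !iM !nl.
  by rewrite kcd pcd.
- by move=> c d [kcd pcd]; rewrite (kP c) (kP d) kcd pcd.
- move=> [a q]; exists (iota a * s q).
  by have [-> ->] := kE _ a q erefl.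
Qed.

Theorem theorem2p4 (K : groupType) (K_abelian : commutative (@mul K))
    (Q : loopType) (Q_C_loop : is_C_loop Q) (C : loopType) :
  (is_C_loop C /\
   exists N : normal_subloop C,
     [/\ (N : set C) `<=` nucleus C,
         isomorphic K (subloop_type N)
       & isomorphic (quotient N) Q])
  <->
  (exists (theta : {multiplicative Q -> aut K}) (f : Q -> Q -> K),
     C_factor_set theta f /\ isomorphic C (twisted_prod theta f)).
Proof.
split=> [[CC [N [NN [j jb] [h hb]]]] | [theta [f [[f1 fC] [phi phib]]]]].
  pose iota a := val (j a); pose p c := h (to_quotient N c).
  have [theta [f [f1 [phi phib]]]] : exists (theta : {multiplicative Q -> aut K})
      (f : Q -> Q -> K), (forall x : Q, f x 1 = 1 /\ f 1 x = 1) /\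
      isomorphic C (twisted_prod theta f).
    have [j' jK j'K] := jb; have [h' hK h'K] := hb.
    apply: (@nuclear_extension_twisted K K_abelian Q C iota p).
    - by move=> a b; rewrite /iota gmulfM.
    - by move=> a b /val_inj /(can_inj jK).
    - by move=> a; apply/NN/set_mem/valP.
    - by move=> x y; rewrite /p to_quotientM gmulfM.
    - move=> q; have [x ex] := to_quotient_surj (h' q).
      by exists x; rewrite /p ex h'K.
    have [NxE lN rN] := normalP N; have [N1 NM Nl _] := subloopP N.
    (* For [n] in [N], left division inside [N] gives [n N = 1 N], so [p] is constant on [N]. *)
    have pN n : (N : set C) n -> p n = p 1.
      move=> Nn; congr (h _); apply: val_inj => /=.
      apply/seteqP; split=> _ [m Nm <-].
        by exists (n * m); [exact: NM | rewrite mul1g].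
      have [k [nk _]] := ldiv_uniq n (1 * m); exists k => //.
      by apply: (Nl n) => //; rewrite nk mul1g.
    move=> x y; split=> [/(can_inj hK)/(congr1 val) /= exy|[a ->]].
      (* [x] lies in [x N = y N], and normality rewrites this as [N y], yielding the left factor
         that the fiber condition asks for. *)
      have : lcos x N x by exists 1; rewrite ?mulg1.
      rewrite exy NxE => -[n Nn <-]; exists (j' (SubloopElt (mem_set Nn))).
      by rewrite /iota j'K.
    rewrite /p to_quotientM gmulfM -/(p _) pN; last exact/set_mem/valP.
    by rewrite /p -gmulfM -to_quotientM mul1g.
  exists theta, f; split; last by exists phi.
  apply/(twisted_C_law _ _ K_abelian f1 Q_C_loop) => u v w.
  have [psi phiK psiK] := phib.
  by rewrite -(psiK u) -(psiK v) -(psiK w) -!gmulfM CC.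
have TC := (twisted_C_law _ _ K_abelian f1 Q_C_loop).2 (conj f1 fC).
have [psi phiK psiK] := phib; have phiI := can_inj phiK.
(* The second coordinate seen through [phi]; its kernel serves as the required normal subloop. *)
pose p c := (phi c).2.
have pM : {morph p : x y / x * y} by move=> x y; rewrite /p gmulfM.
split; first by move=> x y z; apply: phiI; rewrite !gmulfM TC.
have kerE c : p c = 1 -> phi c = ((phi c).1, 1) by rewrite /p; case: (phi c) => ? ? /= ->.
have psiM u v : psi (u * v) = psi u * psi v.
  by apply: phiI; rewrite gmulfM !psiK.
exists (kernel pM); split.
- move=> c /kerE ec x y.
  have [e1 e2 e3] := twisted_nuclear _ _ K_abelian f1 (phi c).1 (phi x) (phi y).
  by split; apply: phiI; rewrite !gmulfM ec.
- have kP a : psi (a, 1) \in (kernel pM : set C).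
    by apply/mem_set; rewrite /= /p psiK.
  apply: (@isomorphic_of_morph _ _ (fun a => SubloopElt (kP a))).
  + move=> a b; apply: val_inj; rewrite /= -psiM.
    by rewrite (twisted_mul1 _ _ f1).
  + by move=> a b /(congr1 val) /= /(can_inj psiK) [].
  + move=> c; exists (phi (val c)).1; apply: val_inj => /=.
    by rewrite -kerE ?phiK //; exact: (set_mem (valP c)).
- by apply: kernel_quotient_isomorphic => q; exists (psi (1, q)); rewrite /p psiK.
Qed.
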